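(* For each $t\in[0,1)$ the spectra of $C_t\in\mathcal{L}(\omega)$ are given by $$\sigma(C_t;\omega)=\sigma_{pt}(C_t;\omega)=\Lambda,$$ with each eigenvalue being simple, and $$\sigma^*(C_t;\omega)=\Lambda\cup\{0\}.$$ The $1$-dimensional eigenspace corresponding to the eigenvalue $\frac{1}{m+1}\in\Lambda$ is spanned by $x^{[m]}$, for each $m\in\mathbb{N}_0$.
   Context: $\mathbb{N}_0=\{0,1,2,\dots\}$ and $\omega:=\mathbb{C}^{\mathbb{N}_0}$ is the Fréchet space of all complex sequences with the topology of coordinatewise convergence. For $t\in[0,1]$, $C_tx:=\left(\frac{t^nx_0+t^{n-1}x_1+\dots+x_n}{n+1}\right)_{n\in\mathbb{N}_0}$ for $x\in\omega$ (with $0^0:=1$). $\Lambda:=\{\frac{1}{n+1}:n\in\mathbb{N}_0\}$. For $t\in[0,1)$ and $m\in\mathbb{N}$ define $$x^{[m]}:=\alpha_m\left(0,\dots,0,1,\frac{(m+1)!}{m!\,1!}t,\frac{(m+2)!}{m!\,2!}t^2,\frac{(m+3)!}{m!\,3!}t^3,\dots\right)$$ with $\alpha_m\in\mathbb{C}\setminus\{0\}$ arbitrary, where $1$ is in position $m$ (positions start at $0$), and $x^{[0]}:=\alpha_0(t^n)_{n\in\mathbb{N}_0}$ with $\alpha_0\in\mathbb{C}\setminus\{0\}$ arbitrary. For a locally convex Hausdorff space $X$ let $\mathcal{L}(X)$ be the space of continuous linear operators on $X$. For $T\in\mathcal{L}(X)$: the resolvent set $\rho(T;X)$ is the set of $\lambda\in\mathbb{C}$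 such that $R(\lambda,T):=(\lambda I-T)^{-1}$ exists in $\mathcal{L}(X)$; $\sigma(T;X):=\mathbb{C}\setminus\rho(T;X)$; $\sigma_{pt}(T;X)$ is the set of $\lambda\in\mathbb{C}$ such that $\lambda I-T$ is not injective (eigenvalues); an eigenvalue $\lambda$ is simple if $\dim\mathrm{Ker}(\lambda I-T)=1$. $\rho^*(T;X)$ is the set of $\lambda\in\mathbb{C}$ for which there is $\delta>0$ such that the open disc $B(\lambda,\delta)\subseteq\rho(T;X)$ and $\{R(\mu,T):\mu\in B(\lambda,\delta)\}$ is an equicontinuous subset of $\mathcal{L}(X)$; $\sigma^*(T;X):=\mathbb{C}\setminus\rho^*(T;X)$. *)

(* Defs.v *)
From HB Require Import structures.
From mathcomp Require Import all_boot all_order all_algebra.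
From mathcomp Require Import finmap.
From mathcomp Require Import all_classical all_reals all_analysis.
From mathcomp Require Import complex.
From mathcomp Require Import ring.

Set Implicit Arguments.
Unset Strict Implicit.
Unset Printing Implicit Defensive.

Import Order.TTheory GRing.Theory Num.Theory.
Import numFieldNormedType.Exports.

Local Open Scope classical_set_scope.
Local Open Scope ring_scope.

(* A locally convex Hausdorff space over [K]. The uniformity of a [tvsType] is
   tied to its vector space structure only through the topology; requiring
   subtraction to be uniformly continuous forces it to be the translation
   invariant one, so that [equicontinuous] has its usual meaning for sets of
   linear operators. *)
HB.mixin Record Tvs_isLCHausdorff (K : numFieldType) (E : Type) & Tvs K E := {
  lc_hausdorff : hausdorff_space E ;
  lc_sub_unif_continuous : unif_continuous (fun x : E * E => x.1 - x.2)
}.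

#[short(type="lcHausdorffType")]
HB.structure Definition LCHausdorff (K : numFieldType) :=
  {E of Tvs K E & Tvs_isLCHausdorff K E}.

(* [equicontinuous] asks for a pointed codomain. *)
HB.instance Definition _ (K : numFieldType) (X : lcHausdorffType K) :=
  isPointed.Build X 0.

Section spectra.
Variables (K : numFieldType) (X : lcHausdorffType K).
Implicit Types (T S : X -> X) (lam mu : K).

(* L(X) *)
Definition clin : set (X -> X) := [set T | linear T /\ continuous T].

(* [S] is R(lam, T) = (lam I - T)^-1 in L(X); such an [S] is unique. *)
Definition is_resolvent T lam S :=
  [/\ clin S, cancel (fun x => lam *: x - T x) S
    & cancel S (fun x => lam *: x - T x)].

Definition op_resolvent_set T : set K := [set lam | exists S, is_resolvent T lam S].

Definition op_spectrum T : set K := ~` op_resolvent_set T.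

Definition op_eigenspace T lam : set X := [set x | lam *: x - T x = 0].

Definition op_point_spectrum T : set K :=
  [set lam | ~ injective (fun x => lam *: x - T x)].

Definition has_dim (V : set X) (n : nat) :=
  exists2 e : 'I_n -> X,
    forall c : 'I_n -> K, \sum_i c i *: e i = 0 -> forall i, c i = 0
    & V = [set \sum_i c i *: e i | c in [set: 'I_n -> K]].

Definition simple_eigenvalue T lam :=
  op_point_spectrum T lam /\ has_dim (op_eigenspace T lam) 1.

Definition op_resolvent_set_star T : set K :=
  [set lam | exists2 delta : K, 0 < delta &
     ball (lam : K^o) delta `<=` op_resolvent_set T /\
     equicontinuous
       [set S | exists2 mu, ball (lam : K^o) delta mu & is_resolvent T mu S] id].

Definition op_spectrum_star T : set K := ~` op_resolvent_set_star T.

End spectra.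

(* The space of all sequences, with the topology of coordinatewise convergence;
   K^o is the field K seen as a topological vector space over itself. *)
Definition omega (K : numFieldType) := prod_topology (fun _ : nat => K^o).

Section omega_structure.
Variable K : numFieldType.
Local Notation W := (omega K).

HB.instance Definition _ := Uniform.copy W (prod_topology (fun _ : nat => K^o)).
HB.instance Definition _ := GRing.Lmodule.copy W (nat -> K^o).

Let W_ent (A : set (W * W)) := exists n (V : set (K^o * K^o)), entourage V /\
  forall x y : W, (forall i : 'I_n, V (x i, y i)) -> A (x, y).

#[local] Instance W_ent_filter : Filter W_ent.
Proof.
split.
- by exists 0%N, setT; split => //; exact: entourageT.
- move=> A B [n [V [entV VA]]] [m [U [entU UB]]].
  exists (n + m)%N, (V `&` U); split; first exact: filterI.
  move=> x y xy; split.
    by apply: VA => i; have [] := xy (lshift m i).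
  apply: UB => i.
  have im : (i < n + m)%N by rewrite (leq_trans (ltn_ord i))// leq_addl.
  by have [] := xy (Ordinal im).
- move=> A B AB [n [V [entV VA]]]; exists n, V; split => // x y /VA.
  exact: AB.
Qed.

Lemma omega_entourageE (A : set (W * W)) : entourage A <->
  exists n (V : set (K^o * K^o)), entourage V /\
    forall x y : W, (forall i : 'I_n, V (x i, y i)) -> A (x, y).
Proof.
split.
  move=> [B [F _ <-] BA]; suff : W_ent A by [].
  apply: (filterS BA).
  apply: (@filter_bigI _ _ F) => -[[i C] /= Cp] _ /=.
  have /asboolP[V entV VC] := Cp.
  exists i.+1, V; split => // x y xy; apply: VC => /=.
  exact: (xy ord_max).
move=> [n [V [entV VA]]].
suff : \forall z \near @entourage W,
    forall i : 'I_n, V ((z : W * W).1 i, (z : W * W).2 i).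
  by apply: filterS => -[x y]; exact: VA.
apply: filter_forall => i.
pose C := [set z : W * W | V (z.1 i, z.2 i)].
have p : `[< @entourage (initial_topology (@proj _ (fun _ : nat => K^o) i)) C >].
  by apply/asboolP; exists V.
exists C; last by [].
unshelve eexists; first by apply: fset1; exists (i : nat, C).
- by move=> z _; rewrite inE.
by rewrite set_fset1 bigcap_set1.
Qed.

Lemma omega_nbhsE (x : W) (A : set W) : nbhs x A <->
  exists n (V : set (K^o * K^o)), entourage V /\
    forall y : W, (forall i : 'I_n, V (x i, y i)) -> A y.
Proof.
split.
  move=> /nbhsP[E /omega_entourageE[n [V [entV VE]]] EA].
  exists n, V; split=> // y xy; apply: EA; apply/xsectionP; exact: VE.
move=> [n [V [entV VA]]]; apply/nbhsP.
exists [set z : W * W | forall i : 'I_n, V (z.1 i, z.2 i)].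
  by apply/omega_entourageE; exists n, V.
by move=> y /xsectionP /=; exact: VA.
Qed.

Lemma omega_cvgP (F : set_system W) (x : W) : Filter F ->
  F --> x <-> forall i : nat, (fun y : W => y i) @ F --> (x i : K^o).
Proof.
move=> FF; split.
  move=> Fx i B /nbhsP[V entV VB]; apply: Fx.
  apply/omega_nbhsE; exists i.+1, V; split=> // y xy.
  by apply: VB; apply/xsectionP; exact: (xy ord_max).
move=> Fx A /omega_nbhsE[n [V [entV VA]]].
suff : \forall y \near F, forall i : 'I_n, V (x i, (y : W) i).
  by apply: filterS => y; exact: VA.
apply: filter_forall => i.
have /Fx : nbhs (x i : K^o) (xsection V (x i)) by apply/nbhsP; exists V.
move=> FV; have {}FV : F [set y : W | xsection V (x i) (y i)] by [].
by apply: (@filterS _ F FF _ _ _ FV) => y; exact: (iffLR (xsectionP _ _ _)).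
Qed.

Lemma omega_hausdorff : hausdorff_space W.
Proof. apply: hausdorff_product => _. exact: norm_hausdorff. Qed.

Lemma omega_coord_continuous (i : nat) : continuous (fun x : W => x i : K^o).
Proof. by move=> x; have [+ _] := omega_cvgP x (nbhs_filter x); apply. Qed.

Let omega_sub_unif_continuous : unif_continuous (fun x : W * W => x.1 - x.2).
Proof.
move=> A /omega_entourageE[n [V [entV VA]]].
have [e e0 eV] : exists2 e : K, 0 < e & forall a b : K^o, ball a e b -> V (a, b).
  have : entourage V by [].
  rewrite -entourage_ballE => -[e /= e0 eV]; exists e => // a b ab.
  exact: eV.
pose D : set (W * W) :=
  [set z : W * W | forall i : 'I_n, ball (z.1 i : K^o) (e / 2) (z.2 i)].
have entD : entourage D.
  apply/omega_entourageE; exists n, [set z : K^o * K^o | ball z.1 (e / 2) z.2]; split => //.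
  by apply: entourage_ball (PosNum (divr_gt0 e0 _)).
exists (D, D); first by split.
move=> [[x1 x2] [y1 y2]] /= [/= h1 h2].
exists ((x1, y1), (x2, y2)) => //=.
apply: (VA (x1 - y1) (x2 - y2)) => i; apply: eV.
move: (h1 i) (h2 i); rewrite -!ball_normE /= => h1i h2i.
rewrite (_ : _ - _ = (x1 i - x2 i) - (y1 i - y2 i)).
  by rewrite (splitr e) (le_lt_trans (ler_normB _ _))// ltrD.
by change (x1 i - y1 i - (x2 i - y2 i) = (x1 i - x2 i) - (y1 i - y2 i)); ring.
Qed.

Lemma omega_continuous (T : topologicalType) (f : T -> W) :
  (forall i, continuous (fun z => f z i : K^o)) -> continuous f.
Proof.
move=> fc z.
have [_] := @omega_cvgP (f @ z) (f z) _; apply=> i.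
exact: fc.
Qed.

Let omega_add_continuous : continuous (fun x : W * W => x.1 + x.2).
Proof.
apply: omega_continuous => i -[x y].
pose p : W -> K^o := fun x => x i.
have c1 : (p \o fst) @ (x, y) --> p x.
  by apply: continuous_comp; [exact: cvg_fst|exact: omega_coord_continuous].
have c2 : (p \o snd) @ (x, y) --> p y.
  by apply: continuous_comp; [exact: cvg_snd|exact: omega_coord_continuous].
exact: (cvgD c1 c2).
Qed.

Let omega_scale_continuous : continuous (fun x : K^o * W => x.1 *: x.2).
Proof.
apply: omega_continuous => i -[a x].
pose p : W -> K^o := fun x => x i.
have c1 : (fst : K^o * W -> K^o) @ (a, x) --> a by exact: cvg_fst.
have c2 : ((p \o snd) : K^o * W -> K^o) @ (a, x) --> p x.
  by apply: continuous_comp; [exact: cvg_snd|exact: omega_coord_continuous].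
exact: (cvgZ c1 c2).
Qed.

Let ball_convex (x : K^o) (e : K) : convex_set (ball x e).
Proof.
apply/convex_setW => z y; rewrite !inE -!ball_normE /= => zx yx l l0 l1.
rewrite inE/=.
have l1' : 0 < 1 - l%:num by rewrite subr_gt0.
set w := conv l _ _; have {w}-> : x - w = l%:num * (x - z) + (1 - l%:num) * (x - y).
  by rewrite (_ : w = l%:num * z + (1 - l%:num) * y)//; ring.
rewrite (le_lt_trans (ler_normD _ _))// !normrM.
rewrite (ger0_norm (ltW l0)) (ger0_norm (ltW l1')).
rewrite (_ : e = l%:num * e + (1 - l%:num) * e); last by ring.
by rewrite ltrD// ltr_pM2l.
Qed.

Let omega_locally_convex :
  exists2 B : set_system W, (forall b, b \in B -> convex_set b) & basis B.
Proof.
exists [set b | convex_set b /\ open b]; first by move=> b /set_mem[].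
split; first by move=> b [].
move=> x A /omega_nbhsE[n [V [entV VA]]].
have : entourage V by [].
rewrite -entourage_ballE => -[e /= e0 eV].
exists [set y : W | forall i : 'I_n, ball (x i : K^o) e (y i)]; last first.
  by move=> y xy; apply: VA => i; apply: eV; exact: xy.
split; last by move=> i /=; exact: ballxx e0.
split.
  move=> y z l /set_mem yx /set_mem zx; apply/mem_set => i.
  exact: set_mem (ball_convex l (mem_set (yx i)) (mem_set (zx i))).
rewrite openE => y /= xy.
suff : \forall z \near (y : W), forall i : 'I_n, ball (x i : K^o) e ((z : W) i) by [].
apply: (@filter_forall _ _ _ (nbhs (y : W))) => i; apply: (@omega_coord_continuous i y).
by apply: open_nbhs_nbhs; split; [exact: ball_open|exact: xy].
Qed.

HB.instance Definition _ :=
  PreTopologicalNmodule_isTopologicalNmodule.Build W omega_add_continuous.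
HB.instance Definition _ :=
  TopologicalNmodule_isTopologicalLmodule.Build K W omega_scale_continuous.
HB.instance Definition _ := Uniform_isTvs.Build K W omega_locally_convex.
HB.instance Definition _ :=
  Tvs_isLCHausdorff.Build K W omega_hausdorff omega_sub_unif_continuous.

End omega_structure.

Section generalized_cesaro.
Variable K : numFieldType.
Implicit Types (t a : K) (x : omega K).

Definition gcesaro t x : omega K :=
  fun n => (\sum_(i < n.+1) t ^+ (n - i) * x i) / n.+1%:R.

Definition Lambda : set K := [set n.+1%:R^-1 | n in [set: nat]].

(* x^[m] with alpha_m = a; the coefficient (m + k)! / (m! k!) sits in position
   n = m + k. For m = 0 this is a (t^n)_n, see [eigvec0]. *)
Definition eigvec t a m : omega K := fun n =>
  if (n < m)%N then 0
  else a * (n`!%:R / (m`!%:R * (n - m)`!%:R) * t ^+ (n - m)).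

Lemma eigvec0 t a : eigvec t a 0 = (fun n => a * t ^+ n).
Proof.
apply/funext => n; rewrite /eigvec ltn0 subn0 fact0 mul1r divff; first by rewrite mul1r.
by rewrite pnatr_eq0 -lt0n fact_gt0.
Qed.

End generalized_cesaro.
Arguments Lambda : clear implicits.

(* Main.v *)
Require Import Defs.
From HB Require Import structures.
From mathcomp Require Import all_boot all_order all_algebra.
From mathcomp Require Import all_classical all_reals all_analysis.
From mathcomp Require Import complex.
From mathcomp Require Import ring.

(* The operator [lam I - C_t] is lower triangular with diagonal entries
   [lam - 1/(n+1)]. If none of them vanishes, forward substitution inverts it,
   and the n-th coordinate of the inverse depends on the first n+1 coordinates
   only, with a bound that is determined by lower bounds for the first n+1
   diagonal entries. These are uniform on a small disc around
   [lam] outside [Lambda `|` [set 0]], whence the equicontinuity of the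
   resolvents there, and every disc around 0 meets [Lambda]. At [lam = 1/(m+1)]
   the only free coordinate of a solution of [C_t x = lam x] is [x m], so the
   eigenspace is at most one-dimensional; it contains [x^[m]] by the recursion
   [(n+1-m) x^[m]_(n+1) = t (n+1) x^[m]_n]. *)

Set Implicit Arguments.
Unset Strict Implicit.
Unset Printing Implicit Defensive.

Import Order.TTheory GRing.Theory Num.Theory.
Import numFieldNormedType.Exports.

Local Open Scope classical_set_scope.
Local Open Scope ring_scope.
Local Open Scope complex_scope.

(* The pointed structure required by [equicontinuous] is the one that every
   [lcHausdorffType] carries. *)
Definition omega_lc (K : numFieldType) : lcHausdorffType K := omega K.

(** * Equicontinuity from coordinatewise bounds *)

(** A basic entourage tests finitely many coordinates, and by linearity these are controlled by
    finitely many coordinates of [x - y], with constants common to all of [A]. *)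
Lemma omega_equicontinuous (K : numFieldType) (B : nat -> K)
    (A : set (omega_lc K -> omega_lc K)) :
  (forall n, 0 <= B n) ->
  (forall T, A T -> linear T) ->
  (forall T (x : omega K) (e : K) n, A T ->
     (forall i, (i <= n)%N -> `|x i| <= e) -> `|T x n| <= B n * e) ->
  equicontinuous A id.
Proof.
move=> B0 linA boundA x E /omega_entourageE[n [V [entV VE]]].
have [e e0 eV] : exists2 e : K, 0 < e & forall a b : K^o, ball a e b -> V (a, b).
  have : entourage V by [].
  rewrite -entourage_ballE => -[e /= e0 eV]; exists e => // a b ab.
  exact: eV.
(* The sum dominates every [B i] with [i < n]; the added 1 makes [D] positive and the final estimate
   strict. *)
pose D := \sum_(i < n) B i + 1.
have D0 : 0 < D by rewrite ltr_wpDl// sumr_ge0.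
apply/omega_nbhsE; exists n, [set z : K^o * K^o | ball z.1 (e / D) z.2].
split; first exact: entourage_ball (PosNum (divr_gt0 e0 D0)).
move=> y xy T AT; apply: VE => i; apply: eV; rewrite -ball_normE /=.
have -> : T x i - T y i = T (x - y) i.
  have := linA _ AT (-1) y x; rewrite scaleN1r [- y + x]addrC => ->.
  by rewrite scaleN1r addrC.
apply: (le_lt_trans (boundA _ _ (e / D) _ AT _)).
  move=> j ji; have jn := leq_ltn_trans ji (ltn_ord i).
  by have := xy (Ordinal jn); rewrite -ball_normE /= => /ltW.
rewrite mulrCA gtr_pMr// ltr_pdivrMr// mul1r /D (bigD1 i)//=.
by rewrite ltr_pwDr// lerDl sumr_ge0.
Qed.

Lemma equicontinuous_mem_continuous (K : numFieldType) (X : lcHausdorffType K)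
    (A : set (X -> X)) T : equicontinuous A id -> A T -> continuous T.
Proof. exact: (equicontinuous_continuous (fW := id)). Qed.

(** * Inversion by forward substitution *)

Section cesaro_resolvent.
Variables (K : numFieldType) (t : K).
Implicit Types (lam : K) (x y : omega K).

(** Indexed by the number of terms: index 0 is the empty sum, and index [n.+1] is the numerator of
    coordinate [n] of [gcesaro t x]. *)
Definition discounted_sum x n : K := \sum_(i < n) t ^+ (n.-1 - i) * x i.

Lemma discounted_sum0 x : discounted_sum x 0 = 0.
Proof. exact: big_ord0. Qed.

Lemma discounted_sumS x n :
  discounted_sum x n.+1 = t * discounted_sum x n + x n.
Proof.
rewrite /discounted_sum big_ord_recr /= subnn expr0 mul1r mulr_sumr.
congr (_ + _); apply: eq_bigr => i _; rewrite mulrA -exprS.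
by case: n i => [[]//|n] i; rewrite subSn// -ltnS.
Qed.

Lemma gcesaroE x n : gcesaro t x n = (t * discounted_sum x n + x n) / n.+1%:R.
Proof. by rewrite -discounted_sumS. Qed.

Lemma sub_gcesaroE lam x n : (lam *: x - gcesaro t x) n =
  (lam - n.+1%:R^-1) * x n - t * discounted_sum x n / n.+1%:R.
Proof.
have -> : (lam *: x - gcesaro t x) n = lam * x n - gcesaro t x n by [].
by rewrite gcesaroE; ring.
Qed.

(* Forward substitution: [resolvent_sum lam y] is the sequence of discounted
   sums of the solution [x] of [lam *: x - gcesaro t x = y]. *)
Fixpoint resolvent_sum lam y n : K :=
  if n is m.+1 then
    t * resolvent_sum lam y m +
    (y m + t * resolvent_sum lam y m / m.+1%:R) / (lam - m.+1%:R^-1)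
  else 0.

Definition resolvent lam y : omega K := fun n =>
  (y n + t * resolvent_sum lam y n / n.+1%:R) / (lam - n.+1%:R^-1).

Lemma discounted_sum_resolvent lam y n :
  discounted_sum (resolvent lam y) n = resolvent_sum lam y n.
Proof.
elim: n => [|n IHn]; first exact: discounted_sum0.
by rewrite discounted_sumS IHn.
Qed.

Lemma sub_Lambda_neq0 lam n : ~ Lambda K lam -> lam - n.+1%:R^-1 != 0.
Proof. by move=> lamL; rewrite subr_eq0; apply/eqP => e; apply: lamL; exists n. Qed.

Lemma resolventK lam : ~ Lambda K lam ->
  cancel (resolvent lam) (fun x => lam *: x - gcesaro t x).
Proof.
move=> lamL y; apply/funext => n.
rewrite sub_gcesaroE discounted_sum_resolvent /resolvent.
by rewrite mulrCA divff ?sub_Lambda_neq0// mulr1 addrK.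
Qed.

(** Solving coordinate [n] for [x n] gives the recursion that defines [resolvent], so the discounted
    sums agree by induction. *)
Lemma sub_gcesaroK lam : ~ Lambda K lam ->
  cancel (fun x => lam *: x - gcesaro t x) (resolvent lam).
Proof.
move=> lamL x; set y := lam *: x - gcesaro t x.
have xE n : x n =
    (y n + t * discounted_sum x n / n.+1%:R) / (lam - n.+1%:R^-1).
  by rewrite /y sub_gcesaroE subrK mulrAC divff ?mul1r// sub_Lambda_neq0.
apply/funext => n; rewrite [RHS]xE; congr ((_ + t * _ / _) / _).
elim: n => [|n IHn]; first by rewrite discounted_sum0.
by rewrite discounted_sumS xE /= IHn.
Qed.

Lemma linear_discounted_sum n (a : K) x y :
  discounted_sum (a *: x + y) n = a * discounted_sum x n + discounted_sum y n.
Proof.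
elim: n => [|n IHn]; first by rewrite !discounted_sum0; ring.
rewrite !discounted_sumS IHn.
have -> : (a *: x + y) n = a * x n + y n by [].
ring.
Qed.

Lemma linear_gcesaro : linear (gcesaro t).
Proof.
move=> a x y; apply/funext => n.
have -> : (a *: gcesaro t x + gcesaro t y) n = a * gcesaro t x n + gcesaro t y n.
  by [].
rewrite !gcesaroE linear_discounted_sum.
have -> : (a *: x + y) n = a * x n + y n by [].
ring.
Qed.

Lemma linear_resolvent lam : linear (resolvent lam).
Proof.
move=> a x y.
have sumE n : resolvent_sum lam (a *: x + y) n =
    a * resolvent_sum lam x n + resolvent_sum lam y n.
  elim: n => [|n /= ->]; first by rewrite /=; ring.
  have -> : (a *: x + y) n = a * x n + y n by [].
  ring.
apply/funext => n.
have -> : (a *: resolvent lam x + resolvent lam y) n =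
  a * resolvent lam x n + resolvent lam y n by [].
rewrite /resolvent sumE.
have -> : (a *: x + y) n = a * x n + y n by [].
ring.
Qed.

(** * Continuity and uniform bounds *)

Lemma continuous_gcesaro : continuous (gcesaro t).
Proof.
(* The absolute row sums of the matrix of [gcesaro t]. *)
pose B n := \sum_(i < n.+1) `|t| ^+ (n - i) / n.+1%:R.
apply: (@equicontinuous_mem_continuous K (omega_lc K) [set gcesaro t]) => //.
apply: (@omega_equicontinuous K B).
- by move=> n; apply: sumr_ge0 => i _; rewrite divr_ge0 ?exprn_ge0.
- by move=> _ ->; exact: linear_gcesaro.
move=> _ x e n -> xe; rewrite /gcesaro /B mulr_suml mulr_suml.
rewrite (le_trans (ler_norm_sum _ _ _))// ler_sum// => i _.
rewrite !normrM normrX normfV normr_nat mulrAC ler_wpM2l//.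
by rewrite xe// -ltnS.
Qed.

(** Majorizes [resolvent_sum] for data of absolute value at most 1: [d m] bounds the diagonal entry
    from below and the factor [m.+1%:R^-1] is estimated by 1. Only [d] enters, so the bound is
    uniform in [lam]. *)
Fixpoint resolvent_sum_bound (d : nat -> K) n : K :=
  if n is m.+1 then
    `|t| * resolvent_sum_bound d m + (1 + `|t| * resolvent_sum_bound d m) / d m
  else 0.

Lemma resolvent_sum_bound_ge0 (d : nat -> K) n :
  (forall k, 0 < d k) -> 0 <= resolvent_sum_bound d n.
Proof.
move=> d0; elim: n => //= n IHn.
by rewrite addr_ge0 ?mulr_ge0 ?addr_ge0 ?mulr_ge0 ?invr_ge0// ltW.
Qed.

Lemma resolvent_step_le lam (d e s y : K) n : 0 < d -> 0 <= s ->
  d <= `|lam - n.+1%:R^-1| -> forall r, `|y| <= e -> `|r| <= s * e ->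
  `|(y + t * r / n.+1%:R) / (lam - n.+1%:R^-1)| <= (1 + `|t| * s) / d * e.
Proof.
move=> d0 s0 dlam r ye rse.
have lam0 := lt_le_trans d0 dlam.
rewrite normrM normfV [leRHS]mulrAC ler_pM//.
  rewrite (le_trans (ler_normD _ _))// mulrDl mul1r lerD//.
  rewrite !normrM normfV normr_nat -mulrA -mulrA ler_wpM2l//.
  apply: le_trans rse; rewrite ler_piMr// invf_le1 ?ltr0n//.
  by rewrite (ler_nat _ 1).
by rewrite lef_pV2.
Qed.

Lemma resolvent_sum_le lam (d : nat -> K) : (forall n, 0 < d n) ->
  (forall n, d n <= `|lam - n.+1%:R^-1|) ->
  forall y (e : K) n, (forall i, (i < n)%N -> `|y i| <= e) ->
  `|resolvent_sum lam y n| <= resolvent_sum_bound d n * e.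
Proof.
move=> d0 dlam y e; elim=> [_|n IHn ye] /=; first by rewrite normr0 mul0r.
have {}IHn := IHn (fun i ni => ye i (ltnW ni)).
rewrite (le_trans (ler_normD _ _))// [leRHS]mulrDl lerD//.
  by rewrite normrM -mulrA ler_wpM2l.
by rewrite resolvent_step_le ?resolvent_sum_bound_ge0 ?ye.
Qed.

(** Letting [d] vary with [n] serves two uses: a single resolvent, with [d] the diagonal distances
    themselves, and a whole disc, with [d] constant. *)
Lemma resolvent_equicontinuous (A : set K) (d : nat -> K) :
  (forall n, 0 < d n) -> (forall mu n, A mu -> d n <= `|mu - n.+1%:R^-1|) ->
  @equicontinuous (omega_lc K) (omega_lc K) _ [set resolvent mu | mu in A] id.
Proof.
move=> d0 dA.
apply: (@omega_equicontinuous K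
  (fun n => (1 + `|t| * resolvent_sum_bound d n) / d n)).
- by move=> n; rewrite divr_ge0 ?(ltW (d0 _))// addr_ge0 ?mulr_ge0 ?resolvent_sum_bound_ge0.
- by move=> _ [mu _ <-]; exact: linear_resolvent.
move=> _ y e n [mu Amu <-] ye.
have dmu k := dA mu k Amu.
rewrite resolvent_step_le ?resolvent_sum_bound_ge0 ?ye//.
by apply: resolvent_sum_le => // i /ltnW; exact: ye.
Qed.

Lemma is_resolvent_resolvent lam : ~ Lambda K lam ->
  is_resolvent (gcesaro t) lam (resolvent lam).
Proof.
move=> lamL; split; [split|exact: sub_gcesaroK|exact: resolventK].
  exact: linear_resolvent.
apply: (@equicontinuous_mem_continuous K (omega_lc K)
  [set resolvent mu | mu in [set lam]]); last by exists lam.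
apply: (@resolvent_equicontinuous _ (fun n => `|lam - n.+1%:R^-1|)).
  by move=> n; rewrite normr_gt0 sub_Lambda_neq0.
by move=> _ n ->.
Qed.

Lemma is_resolvent_uniq (X : lcHausdorffType K) (T S S' : X -> X) lam :
  is_resolvent T lam S -> is_resolvent T lam S' -> S = S'.
Proof.
move=> [_ TS _] [_ _ S'T]; apply/funext => x.
by rewrite -[in LHS](S'T x) TS.
Qed.

End cesaro_resolvent.

Lemma linear_scale_sub (K : numFieldType) (V : lmodType K) (T : V -> V) lam :
  linear T -> linear (fun x => lam *: x - T x).
Proof.
move=> linT c x y; rewrite linT scalerBr scalerDr !scalerA [lam * c]mulrC.
by rewrite opprD addrACA.
Qed.

(** * Eigenvectors and spectra *)

Section cesaro_spectra.
Variables (K : numFieldType) (t : K).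
Implicit Types (a lam : K) (x : omega K).

Lemma eigvec_diag a m : eigvec t a m m = a.
Proof.
by rewrite /eigvec ltnn subnn fact0 expr0 !mulr1 divff ?mulr1// pnatr_eq0 -lt0n fact_gt0.
Qed.

Lemma eigvecS a m n :
  (n.+1%:R - m%:R) * eigvec t a m n.+1 = t * (n.+1%:R * eigvec t a m n).
Proof.
have [nm|mn] := ltnP n m.
  rewrite [eigvec t a m n]/eigvec nm !mulr0.
  (* At [n.+1 = m] the entry is [a], and it is the left factor that vanishes. *)
  have [->|Snm] := eqVneq n.+1 m; first by rewrite subrr mul0r.
  by rewrite /eigvec ltn_neqAle Snm nm mulr0.
rewrite /eigvec ltnNge (leqW mn) ltnNge mn /=.
rewrite -natrB ?leqW// subSn// !factS exprS !natrM.
have f0 k : (k`!%:R : K) != 0 by rewrite pnatr_eq0 -lt0n fact_gt0.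
have s0 : ((n - m).+1%:R : K) != 0 by rewrite pnatr_eq0.
move: (f0 m) (f0 (n - m)%N) s0; set u := _.+1%:R; move: u => u.
set f := m`!%:R; set g := (n - m)`!%:R => fn0 gn0 un0.
by field; rewrite un0 gn0 fn0.
Qed.

(** Divided by [n.+1], this is the eigenvalue equation. In the induction [eigvecS] produces the
    factor n+1-m, and the new term, after multiplication by m+1, raises it to n+2. *)
Lemma discounted_sum_eigvec a m n :
  discounted_sum t (eigvec t a m) n.+1 = n.+1%:R / m.+1%:R * eigvec t a m n.
Proof.
elim: n => [|n IHn].
  rewrite discounted_sumS discounted_sum0 mulr0 add0r.
  case: m => [|m]; first by rewrite divff ?mul1r.
  by rewrite /eigvec mulr0.
have m0 : (m.+1%:R : K) != 0 by rewrite pnatr_eq0.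
rewrite discounted_sumS IHn; apply: (mulfI m0).
rewrite mulrDr; have -> : m.+1%:R * (t * (n.+1%:R / m.+1%:R * eigvec t a m n)) =
    t * (n.+1%:R * eigvec t a m n).
  by field.
rewrite -eigvecS; field.
by rewrite nat1r.
Qed.

Lemma gcesaro_eigvec a m :
  gcesaro t (eigvec t a m) = m.+1%:R^-1 *: eigvec t a m.
Proof.
apply/funext => n; rewrite gcesaroE -discounted_sumS discounted_sum_eigvec.
by rewrite mulrC -!mulrA mulKf ?pnatr_eq0.
Qed.

Lemma eigvec_eigenspace a m :
  op_eigenspace (gcesaro t) m.+1%:R^-1 (eigvec t a m).
Proof. by rewrite /op_eigenspace /= gcesaro_eigvec subrr. Qed.

Lemma gcesaroZ a x : gcesaro t (a *: x) = a *: gcesaro t x.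
Proof.
apply/funext => n; rewrite /gcesaro.
have -> : (a *: (gcesaro t x)) n = a * gcesaro t x n by [].
rewrite /gcesaro mulrA; congr (_ / _); rewrite mulr_sumr.
by apply: eq_bigr => i _; rewrite mulrCA.
Qed.

(** Only the diagonal entry at [m] vanishes; at any other index a zero discounted sum forces
    [x n = 0], so zeros propagate by induction. *)
Lemma eigenspace_eq0 m x :
  op_eigenspace (gcesaro t) m.+1%:R^-1 x -> x m = 0 -> x = 0.
Proof.
move=> eigx xm0.
have step n : discounted_sum t x n = 0 -> x n = 0.
  move=> sum0; have [->//|nm] := eqVneq n m.
  have : (m.+1%:R^-1 *: x - gcesaro t x) n = 0 by rewrite eigx.
  rewrite sub_gcesaroE sum0 mulr0 mul0r subr0 => /eqP; rewrite mulf_eq0.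
  by rewrite subr_eq0 (inj_eq invr_inj) eqr_nat eqSS eq_sym (negPf nm) => /eqP.
apply/funext => n; apply: (step); elim: n => [|n IHn]; first exact: discounted_sum0.
by rewrite discounted_sumS IHn (step _ IHn) mulr0 addr0.
Qed.

Lemma op_eigenspace_gcesaro m a : a != 0 ->
  op_eigenspace (gcesaro t) m.+1%:R^-1
  = [set c *: eigvec t a m | c in [set: K]].
Proof.
move=> a0; have lin := linear_scale_sub m.+1%:R^-1 (@linear_gcesaro K t).
apply/seteqP; split=> [x eigx|_ [c _ <-]]; last first.
  by rewrite /op_eigenspace /= gcesaroZ gcesaro_eigvec !scalerA mulrC subrr.
(* This multiple of [eigvec t a m] matches [x] at position [m], so the difference is killed by
   [eigenspace_eq0]. *)
exists (x m / a) => //; apply/esym/subr0_eq; rewrite addrC -scaleNr.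
apply: (@eigenspace_eq0 m).
  rewrite /op_eigenspace /= lin eigx eigvec_eigenspace.
  by rewrite scaler0 addr0.
have -> : (- (x m / a) *: eigvec t a m + x) m =
  - (x m / a) * eigvec t a m m + x m by [].
by rewrite eigvec_diag mulNr divfK// addNr.
Qed.

Lemma eigvec_neq0 a m : a != 0 -> eigvec t a m != 0 :> omega K.
Proof.
by move=> a0; apply/eqP => e0; move: a0; rewrite -(eigvec_diag a m) e0 eqxx.
Qed.

Lemma Lambda_point_spectrum lam :
  Lambda K lam -> op_point_spectrum (gcesaro t) lam.
Proof.
move=> [m _ <-] /(_ (eigvec t 1 m) 0) inj.
have /eqP[] := eigvec_neq0 m (oner_neq0 K); apply: inj.
by rewrite gcesaro_eigvec -(scale0r (0 : omega K)) gcesaroZ !scale0r scaler0 !subrr.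
Qed.

Lemma Lambda_spectrum lam : Lambda K lam -> op_spectrum (gcesaro t) lam.
Proof. by move=> /Lambda_point_spectrum ninj [S [_ TK _]]; exact/ninj/(can_inj TK). Qed.

Lemma spectrum_gcesaro : op_spectrum (gcesaro t) = Lambda K.
Proof.
apply/seteqP; split=> lam; last exact: Lambda_spectrum.
move=> speclam; apply: contrapT => lamL; apply: speclam.
by exists (resolvent t lam); exact: is_resolvent_resolvent.
Qed.

Lemma point_spectrum_gcesaro : op_point_spectrum (gcesaro t) = Lambda K.
Proof.
apply/seteqP; split=> lam; last exact: Lambda_point_spectrum.
move=> ninj; apply: contrapT => lamL; apply: ninj.
exact: (can_inj (@sub_gcesaroK K t lam lamL)).
Qed.

Lemma simple_eigenvalue_gcesaro lam :
  op_point_spectrum (gcesaro t) lam -> simple_eigenvalue (gcesaro t) lam.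
Proof.
move=> ptlam; split=> //.
move: ptlam; rewrite point_spectrum_gcesaro => -[m _ <-].
exists (fun _ => eigvec t 1 m) => [c|].
  rewrite big_ord1 => /(congr1 (fun x => x m)) cm i.
  have : c ord0 * eigvec t 1 m m = 0 := cm.
  by rewrite eigvec_diag mulr1 (ord1 i).
rewrite (op_eigenspace_gcesaro m (oner_neq0 K)); apply/seteqP; split=> x [c _ <-].
  by exists (fun=> c) => //; rewrite big_ord1.
by exists (c ord0) => //; rewrite big_ord1.
Qed.

(** From some index on, the points of [Lambda] have modulus below half of that of [lam], hence stay
    that far from [lam]; the finitely many others are at positive distance. *)
Lemma Lambda_dist lam : (forall e : K, 0 < e -> exists n, n.+1%:R^-1 < e) ->
  lam != 0 -> ~ Lambda K lam ->
  exists2 d : K, 0 < d & forall n, d <= `|lam - n.+1%:R^-1|.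
Proof.
move=> invS_lt lam0 lamL.
have l0 : 0 < `|lam| / 2 by rewrite divr_gt0 ?normr_gt0.
have [N ltN] := invS_lt _ l0.
have dist_gt0 n : 0 < `|lam - n.+1%:R^-1| by rewrite normr_gt0 sub_Lambda_neq0.
(* The inverse of a sum of inverses stands in for a minimum: the order of
     [K] need not be total. *)
pose D := (`|lam| / 2)^-1 + \sum_(i < N) `|lam - i.+1%:R^-1|^-1.
have S0 : 0 <= \sum_(i < N) `|lam - i.+1%:R^-1|^-1.
  by apply: sumr_ge0 => i _; rewrite invr_ge0.
have D0 : 0 < D by rewrite ltr_pwDl ?invr_gt0.
exists D^-1 => [|n]; first by rewrite invr_gt0.
have [nN|Nn] := ltnP n N.
  rewrite -[leRHS]invrK lef_pV2 ?posrE ?invr_gt0// /D (bigD1 (Ordinal nN))//=.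
  rewrite addrCA lerDl addr_ge0 ?invr_ge0 ?(ltW l0)//.
  by apply: sumr_ge0 => i _; rewrite invr_ge0.
apply: (@le_trans _ _ (`|lam| / 2)).
  by rewrite -[leRHS]invrK lef_pV2 ?posrE ?invr_gt0// lerDl.
apply: le_trans (lerB_dist _ _); rewrite lerBrDr [leRHS]splitr lerD2l.
rewrite normfV normr_nat; apply/ltW/le_lt_trans/ltN.
by rewrite lef_pV2 ?posrE ?ltr0n// ler_nat.
Qed.

Lemma resolvent_set_star_gcesaro lam :
  (forall e : K, 0 < e -> exists n, n.+1%:R^-1 < e) ->
  lam != 0 -> ~ Lambda K lam -> op_resolvent_set_star (gcesaro t) lam.
Proof.
move=> invS_lt lam0 lamL; have [d d0 dlam] := Lambda_dist invS_lt lam0 lamL.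
(* Moving [lam] by less than half the distance leaves at least the other half. *)
have d20 : 0 < d / 2 by rewrite divr_gt0.
have dmu mu n : ball (lam : K^o) (d / 2) mu -> d / 2 <= `|mu - n.+1%:R^-1|.
  rewrite -ball_normE /= => /ltW lammu.
  rewrite -(lerD2l (d / 2)) -splitr (le_trans (dlam n))//.
  by rewrite (le_trans (ler_distD mu _ _))// lerD2r.
have muL mu : ball (lam : K^o) (d / 2) mu -> ~ Lambda K mu.
  move=> Bmu [n _ nmu]; have /(lt_le_trans d20) := dmu _ n Bmu.
  by rewrite nmu subrr normr0 ltxx.
exists (d / 2) => //; split=> [mu Bmu|].
  by exists (resolvent t mu); exact/is_resolvent_resolvent/muL.
have := @resolvent_equicontinuous K t (ball (lam : K^o) (d / 2))
  (fun=> d / 2) (fun=> d20) dmu.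
(* By uniqueness, every resolvent at a point of the disc is the explicit one. *)
apply: (@equicontinuous_subset_id (omega_lc K) (omega_lc K)).
move=> S [mu Bmu resS]; exists mu => //.
by apply: is_resolvent_uniq resS; exact/is_resolvent_resolvent/muL.
Qed.

End cesaro_spectra.

(** A positive complex number is real, so the Archimedean property of [R] applies. *)
Lemma invS_lt_complex (R : realType) (e : R[i]) :
  0 < e -> exists n, n.+1%:R^-1 < e.
Proof.
case: e => a b; rewrite ltcE /= => /andP[/eqP -> a0].
have [n] := ltr_add_invr a0; rewrite add0r => na; exists n.
have -> : (n.+1%:R^-1 : R[i]) = (n.+1%:R^-1)%:C.
  by rewrite fmorphV rmorph_nat.
by rewrite ltcE /= eqxx.
Qed.

Theorem theorem3p7 (R : realType) (t : R) (t_ge0 : 0 <= t) (t_lt1 : t < 1) :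
  let C_t : omega R[i] -> omega R[i] := gcesaro t%:C in
  clin C_t /\
  (op_spectrum C_t = op_point_spectrum C_t /\ op_point_spectrum C_t = Lambda R[i]) /\
  (forall lam : R[i], op_point_spectrum C_t lam -> simple_eigenvalue C_t lam) /\
  op_spectrum_star C_t = Lambda R[i] `|` [set 0] /\
  (forall (m : nat) (alpha : R[i]), alpha != 0 ->
     op_eigenspace C_t m.+1%:R^-1
     = [set c *: eigvec t%:C alpha m | c in [set: R[i]]]).
Proof.
move=> C_t; rewrite /C_t {C_t}.
have ptL := point_spectrum_gcesaro t%:C.
split; first by split; [exact: linear_gcesaro|exact: continuous_gcesaro].
have resP lam : lam != 0 -> ~ Lambda R[i] lam ->
    op_resolvent_set_star (gcesaro t%:C) lam.
  exact/resolvent_set_star_gcesaro/invS_lt_complex.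
have star_res lam : op_resolvent_set_star (gcesaro t%:C) lam ->
    op_resolvent_set (gcesaro t%:C) lam.
  by move=> [d d0 [sub _]]; apply: sub; exact: ballxx.
split; first by rewrite ptL spectrum_gcesaro.
split; first by move=> lam; exact: simple_eigenvalue_gcesaro.
split; last by move=> m a a0; exact: op_eigenspace_gcesaro.
apply/seteqP; split=> lam.
  move=> speclam; have [->|lam0] := eqVneq lam 0; [by right|left].
  by apply: contrapT => lamL; apply: speclam; exact: resP.
move=> [lamL /star_res|-> [d d0 [sub _]]]; first exact: Lambda_spectrum.
(* A disc around 0 inside the resolvent set would contain the eigenvalue [n.+1%:R^-1]. *)
have [n nd] := invS_lt_complex d0.
have /Lambda_spectrum : Lambda R[i] n.+1%:R^-1 by exists n.
apply; apply: sub; rewrite -ball_normE /= sub0r normrN normfV normr_nat.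
exact: nd.
Qed.
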